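(* Let $\{X_r\}_{r\ge0}$ be a family of locally finite point processes on the real line, each having almost surely a smallest point, and let $\mathrm N_r(x)$ be the number of points of $X_r$ that are $\le x$. Suppose that there exist constants $\mathfrak a>0$, $M>\sqrt{2/\mathfrak a}$, $\mathrm C>0$, $r_0>0$, $\{\eta_{r,2},\eta_{r,1},\delta_r\}_{r\ge r_0}$ with $0<\eta_{r,1}<\eta_{r,2}<+\infty$, $\delta_r\in(0,\frac{\eta_{r,2}-\eta_{r,1}}5)$, and functions $\{\mu_r,\sigma_r:[\eta_{r,1}r,\eta_{r,2}r]\to[0,+\infty)\}_{r\ge r_0}$ such that: (1) $\mathbb E\big[e^{\gamma\mathrm N_r(xr)}\big]\le\mathrm C\,e^{\gamma\mu_r(xr)+\frac{\gamma^2}2\sigma_r^2(xr)}$ for all $\gamma\in[-M,M]$, all $x\in(\eta_{r,1}+\frac{\delta_r}2,\eta_{r,2}-\frac{\delta_r}2)$ and all $r>r_0$. (2) For each $r>r_0$, the functions $x\mapsto\mu_r(x)$ and $x\mapsto\sigma_r(x)$ are strictly increasing and differentiable, and $\lim_{r\to+\infty}\mu_r((\eta_{r,1}+\delta_r)r)=+\infty$, $\lim_{r\to+\infty}\sigma_r((\eta_{r,1}+\delta_r)r)=+\infty$. Moreover, $x\mapsto x\mu_r'(x)$ is non-decreasing and $$\lim_{r\to+\infty}\ \inf_{x,y\in(\eta_{r,1}+\frac{\delta_r}2,\eta_{r,2}-\frac{\delta_r}2)}\frac{\delta_r r\mu_r'(xr)}{\sigma_r^2(yr)}=+\infty.$$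 (3) For each $r>r_0$, the function $\sigma_r^2\circ\mu_r^{-1}:[\mu_r(\eta_{r,1}r),\mu_r(\eta_{r,2}r)]\to[0,+\infty)$ is strictly concave and strictly increasing, and $(\sigma_r^2\circ\mu_r^{-1})(k)=\mathfrak a\log k+\mathcal O(1)$ as $r\to+\infty$, uniformly for $k\in[\mu_r((\eta_{r,1}+\frac{\delta_r}2)r),\mu_r((\eta_{r,2}-\frac{\delta_r}2)r)]$. (4) The quantities $\eta_{r,1}+\delta_r$ and $\eta_{r,2}-\eta_{r,1}-4\delta_r$ remain bounded away from $0$ as $r\to+\infty$, and $\eta_{r,2}$ remains bounded away from $+\infty$ as $r\to+\infty$. Let $\xi_{r,k}$ denote the $k$-th smallest point of $X_r$, $k\ge1$, and let $\lambda>1$. Then there exist constants $c>0$ and $r_0'>0$ such that for any small enough $\epsilon>0$ and for all $r\ge r_0'$, $$\mathbb P\left(\max_{k\in I_r\cap\mathbb N_{\ge0}}\frac{|\mu_r(\xi_{r,k})-k|}{(\sigma_r^2\circ\mu_r^{-1})(k)}\le\sqrt{\frac2{\mathfrak a}(1+\epsilon)}\right)\ge1-\frac{c\,\mu_r((\eta_{r,1}+\delta_r)r)^{-\frac\epsilon\lambda}}{\epsilon},$$ where $I_r=\big(\mu_r((\eta_{r,1}+2\delta_r)r),\mu_r((\eta_{r,2}-2\delta_r)r)\big)$. In particular, for any $\epsilon>0$, $$\lim_{r\to+\infty}\mathbb P\left(\max_{k\in I_r\cap\mathbb N_{\ge0}}\frac{|\mu_r(\xi_{r,k})-k|}{(\sigma_r^2\circ\mu_r^{-1})(k)}\le\sqrt{\frac2{\mathfrak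 a}}+\epsilon\right)=1.$$
   Context: $\mathbb N_{\ge0}=\{0,1,2,\dots\}$. $\sigma_r^2$ denotes the square of the function $\sigma_r$, and $\mu_r^{-1}$ the inverse of the strictly increasing function $\mu_r$. Since $\mu_r$ is only defined on $[\eta_{r,1}r,\eta_{r,2}r]$, the event in the probability is understood to include that $\xi_{r,k}$ exists and lies in $[\eta_{r,1}r,\eta_{r,2}r]$ for every $k\in I_r\cap\mathbb N_{\ge0}$. *)

(* Defs.v *)
From HB Require Import structures.
From mathcomp Require Export all_boot all_order all_algebra.
From mathcomp Require Export all_classical all_reals all_analysis.
Export Order.TTheory GRing.Theory Num.Theory.
Export numFieldNormedType.Exports.

Set Implicit Arguments.
Unset Strict Implicit.
Unset Printing Implicit Defensive.

Local Open Scope classical_set_scope.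
Local Open Scope ring_scope.

Section PointProcess.
Context {R : realType}.

(* A point process is a random counting measure: a kernel X from the sample
   space to the line, X w A being the number of points in A, counted with
   multiplicity.  Local finiteness is required for every outcome. *)
Definition locally_finite_point_process d (T : measurableType d)
    (X : R.-ker T ~> measurableTypeR R) : Prop :=
  forall (w : T) (A : set (measurableTypeR R)),
    measurable A -> bounded_set (A : set R) ->
    exists n : nat, X w A = n%:R%:E.

Implicit Types (m : set R -> \bar R).

Definition has_smallest_point m : Prop :=
  exists x : R, (0 < m [set x])%E /\ m `]-oo, x[%classic = 0%E.

(* Extended-real valued because a configuration without smallest point may
   have infinitely many points below x. *)
Definition npoints_le m (x : R) : \bar R := m `]-oo, x]%classic.

Definition is_kth_point m (k : nat) (x : R) : Prop :=
  (m `]-oo, x[%classic < k%:R%:E)%E /\ (k%:R%:E <= m `]-oo, x]%classic)%E.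

(* Meaningful only when the k-th point exists; it is then unique. *)
Definition kth_point m (k : nat) : R := xget 0 (is_kth_point m k).

End PointProcess.

Section RealFunctions.
Context {R : realType}.
Implicit Types (D : set R) (f : R -> R).

(* Derivative relative to the domain D, hence one-sided at the endpoints of a
   closed interval: values of f outside D are irrelevant. *)
Definition diff_quotient f (x y : R) : R := (f y - f x) / (y - x).

Definition differentiable_on D f : Prop :=
  forall x, D x -> cvg (diff_quotient f x y @[y --> within D x^']).

Definition derive_on D f (x : R) : R :=
  lim (diff_quotient f x y @[y --> within D x^']).

Definition strictly_increasing_on D f : Prop :=
  forall x y, D x -> D y -> x < y -> f x < f y.

Definition nondecreasing_on D f : Prop :=
  forall x y, D x -> D y -> x <= y -> f x <= f y.

Definition strictly_concave_on D f : Prop :=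
  forall x y t, D x -> D y -> x != y -> 0 < t < 1 ->
    t * f x + (1 - t) * f y < f (t * x + (1 - t) * y).

(* s^2 o m^-1, where m^-1 inverts m restricted to D. *)
Definition sq_comp_inv D (s m : R -> R) (k : R) : R := s (pinv D m k) ^+ 2.

End RealFunctions.

Section Rigidity.
Context {R : realType}.

(* The maximum, over the integers k in ]a, b[, of |mu(xi_k) - k| / v(k), where
   xi_k is the k-th point of m.  The default value 0 plays no role, since the
   ratios are nonnegative and the maximum is compared to a positive bound. *)
Definition max_deviation (m : set R -> \bar R) (mu v : R -> R) (a b : R) : R :=
  \big[Num.max/0]_(0 <= k < (Num.truncn b).+1 | a < k%:R < b)
    (`|mu (kth_point m k) - k%:R| / v k%:R).

(* The event that for every integer k in ]a, b[ the k-th point exists and lies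
   in the domain D of mu, and that the maximal deviation is at most t. *)
Definition rigidity_event d (T : measurableType d)
    (X : R.-ker T ~> measurableTypeR R) (D : set R) (mu v : R -> R)
    (a b t : R) : set T :=
  [set w | (forall k : nat, a < k%:R < b ->
              exists2 x, is_kth_point (X w) k x & D x)
           /\ max_deviation (X w) mu v a b <= t].

End Rigidity.

(* Main.v *)
Require Import Defs.
From mathcomp Require Import lra ring.
Set Implicit Arguments.
Unset Strict Implicit.
Unset Printing Implicit Defensive.
Local Open Scope classical_set_scope.
Local Open Scope ring_scope.

(* Write v = sigma^2 o mu^-1.  Since mu is increasing, |mu(xi_k) - k| <= t v(k)
   says that xi_k lies in an interval [p_k, q_k] with mu(p_k) = k - t v(k) and
   mu(q_k) = k + t v(k), that is, fewer than k points lie in ]-oo, p_k[ and at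
   least k points in ]-oo, q_k].  Each of these fails with probability at most
   a constant times exp(- t^2 v(k) / 2), by the exponential Markov inequality
   with gamma = t at p_k and gamma = - t at q_k; here the logarithmic growth of
   v gives sigma(q_k)^2 = v(k + t v(k)) <= v(k) + O(1).  For
   t^2 = (2 / a) (1 + eps) the bound is of order k^-(1 + eps), and summing over
   k > mu((eta1 + delta) r) gives the theorem.  The lower bound on delta r mu'
   only serves to keep k - t v(k) and k + t v(k) in the range of mu where the
   exponential moments are controlled. *)

(** * Locally finite measures on the line and their [k]-th points *)

Lemma bounded_set_sub_itv (R : realType) (A : set R) (x y : R) :
  A `<=` `[x, y]%classic -> bounded_set A.
Proof.
move=> Axy; exists (`|x| + `|y|); split; first exact: num_real.
move=> K ltK z /Axy; rewrite /= in_itv/= => /andP[xz zy].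
rewrite (le_trans _ (ltW ltK))// ler_norml.
have := ler_norm x; have := ler_norm (- x); rewrite normrN.
by have := ler_norm y; have := ler_norm (- y); rewrite normrN; lra.
Qed.

Section LocallyFinite.
Context {R : realType} (m : {measure set (measurableTypeR R) -> \bar R}).
Hypothesis mfin : forall A : set (measurableTypeR R),
  measurable A -> bounded_set (A : set R) -> exists n : nat, m A = n%:R%:E.

(** Continuity from above makes [m (F n)] tend to 0. Its values are natural numbers, so the first
    one below 1 is already 0. *)
Lemma decreasing_empty_null (F : (set R)^nat) (x y : R) :
  (forall i, measurable (F i : set (measurableTypeR R))) ->
  (forall i, F i `<=` `[x, y]%classic) ->
  {homo F : i j / (i <= j)%N >-> (j <= i)%O} ->
  (forall x, exists i, ~ F i x) -> exists i, m (F i) = 0%E.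
Proof.
move=> mF bF dF F0.
have cap0 : \bigcap_n F n = set0.
  by rewrite -subset0 => z Fz; have [i] := F0 z; apply; exact: Fz.
have mFn i := mfin (mF i) (bounded_set_sub_itv (bF i)).
have : m (F n) @[n --> \oo] --> 0%E.
  rewrite -(measure0 m) -cap0; apply: nonincreasing_cvg_mu => //.
  - by have [n ->] := mFn 0%N; rewrite ltry.
  - by rewrite cap0.
move=> /fine_cvgP[_] /cvgrPdist_lt /(_ 1 ltr01)[N _ /(_ N (leqnn N))] /=.
rewrite sub0r normrN => mFN; exists N.
have [n mFNn] := mFn N; move: mFN; rewrite mFNn /= normr_nat.
by rewrite -[1]/(1%:R) ltr_nat ltnS leqn0 => /eqP ->.
Qed.

(** The intervals [[x - 1/(i+1), x[] decrease to the empty set because [x] itself is excluded. *)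
Lemma null_left (x : R) : exists2 e : R, 0 < e & m `[x - e, x[%classic = 0%E.
Proof.
pose F (i : nat) : set R := `[x - i.+1%:R^-1, x[%classic.
suff [i Fi] : exists i, m (F i) = 0%E by exists i.+1%:R^-1; rewrite ?invr_gt0.
apply: (@decreasing_empty_null _ (x - 1) x).
- by move=> i; exact: measurable_itv.
- move=> i z; rewrite /F /= !in_itv/= => /andP[xz zx].
  have i1 : i.+1%:R^-1 <= 1 :> R by rewrite invf_le1 ?ler1n.
  by move: (i.+1%:R^-1 : R) xz zx i1 => e xz zx i1; apply/andP; split; lra.
- move=> i j ij; rewrite /F; apply/subsetPset => z /=.
  rewrite !in_itv/= => /andP[xz zx].
  have ji : j.+1%:R^-1 <= i.+1%:R^-1 :> R by rewrite lef_pV2 ?posrE ?ler_nat.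
  move: (i.+1%:R^-1 : R) (j.+1%:R^-1 : R) xz zx ji => e e' xz zx ji.
  by apply/andP; split; lra.
- move=> z; have [zx|xz] := ltP z x; last first.
    exists 0%N; rewrite /F/= in_itv/=; apply/negP.
    by rewrite negb_and -?ltNge -?leNgt ?xz ?zx ?orbT.
  have := ltr_add_invr zx; case=> k; rewrite /F => hk; exists k.
  move: (k.+1%:R^-1 : R) hk => e hk.
  rewrite /= in_itv/=; apply/negP; rewrite negb_and -ltNge -leNgt; apply/orP.
  by (left; lra) || (right; lra).
Qed.

Lemma null_right (x : R) : exists2 e : R, 0 < e & m `]x, x + e]%classic = 0%E.
Proof.
pose F (i : nat) : set R := `]x, x + i.+1%:R^-1]%classic.
suff [i Fi] : exists i, m (F i) = 0%E by exists i.+1%:R^-1; rewrite ?invr_gt0.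
apply: (@decreasing_empty_null _ x (x + 1)).
- by move=> i; exact: measurable_itv.
- move=> i z; rewrite /F /= !in_itv/= => /andP[xz zx].
  have i1 : i.+1%:R^-1 <= 1 :> R by rewrite invf_le1 ?ler1n.
  by move: (i.+1%:R^-1 : R) xz zx i1 => e xz zx i1; apply/andP; split; lra.
- move=> i j ij; rewrite /F; apply/subsetPset => z /=.
  rewrite !in_itv/= => /andP[xz zx].
  have ji : j.+1%:R^-1 <= i.+1%:R^-1 :> R by rewrite lef_pV2 ?posrE ?ler_nat.
  move: (i.+1%:R^-1 : R) (j.+1%:R^-1 : R) xz zx ji => e e' xz zx ji.
  by apply/andP; split; lra.
- move=> z; have [xz|zx] := ltP x z; last first.
    exists 0%N; rewrite /F/= in_itv/=; apply/negP.
    by rewrite negb_and -?ltNge -?leNgt ?xz ?zx ?orbT.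
  have := ltr_add_invr xz; case=> k; rewrite /F => hk; exists k.
  move: (k.+1%:R^-1 : R) hk => e hk.
  rewrite /= in_itv/=; apply/negP; rewrite negb_and -ltNge -leNgt; apply/orP.
  by (left; lra) || (right; lra).
Qed.

Lemma le_measure_ray (b1 b2 : bool) (x y : R) :
  (BSide b1 x <= BSide b2 y)%O ->
  (m [set` Interval -oo%O (BSide b1 x)] <=
   m [set` Interval -oo%O (BSide b2 y)])%E.
Proof.
by move=> xy; apply: le_measure; rewrite ?inE; [exact: measurable_itv..|exact: subset_itvl].
Qed.

Lemma le_measure_rayD (b1 b2 : bool) (x y : R) :
  (BSide b1 x <= BSide b2 y)%O ->
  (m [set` Interval -oo%O (BSide b2 y)] <=
   m [set` Interval -oo%O (BSide b1 x)] +
   m [set` Interval (BSide b1 x) (BSide b2 y)])%E.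
Proof.
move=> xy.
have mray (b : itv_bound R) :
    @measurable _ (measurableTypeR R) [set` Interval -oo%O b].
  exact: measurable_itv.
have mitv : @measurable _ (measurableTypeR R)
    [set` Interval (BSide b1 x) (BSide b2 y)] by exact: measurable_itv.
have mU := measureU2 m (mray (BSide b1 x)) mitv.
apply: le_trans mU.
apply: le_measure; rewrite ?inE; first exact: measurable_itv.
  by apply: measurableU; exact: measurable_itv.
have -> := @itv_bndbnd_setU _ R -oo%O (BSide b1 x) (BSide b2 y) isT xy.
exact: subset_refl.
Qed.

(* Local finiteness leaves a gap without points on either side of the infimum of
   the [y] with at least [k] points in [`]-oo, y]], which is thus the k-th point. *)
Lemma kth_point_in_itvP (p q : R) (k : nat) : p <= q ->
  (exists2 x, is_kth_point m k x & p <= x <= q) <->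
  (m `]-oo, p[%classic < k%:R%:E)%E /\ (k%:R%:E <= m `]-oo, q]%classic)%E.
Proof.
move=> pq; split=> [[x [xk kx] /andP[px xq]]|[pk kq]].
  split; first by apply: le_lt_trans xk; apply: le_measure_ray; rewrite bnd_simp.
  by apply: (le_trans kx); apply: le_measure_ray; rewrite bnd_simp.
pose S := [set y | p <= y <= q /\ (k%:R%:E <= m `]-oo, y]%classic)%E].
have Sq : S q by split => //; rewrite pq lexx.
have infS : has_inf S by split; [exists q | exists p => y [/andP[]]].
set x := inf S.
have px : p <= x by apply: lb_le_inf; [exists q | move=> y [/andP[]]].
have xq : x <= q by apply: ge_inf => //; exact: infS.2.
(* Left of [p] the count is controlled by the hypothesis at [p]; from [p] on, by minimality of the
   infimum. *)
have below y : y < x -> (m `]-oo, y]%classic < k%:R%:E)%E.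
  move=> yx; have [yp|py] := ltP y p.
    by apply: le_lt_trans pk; apply: le_measure_ray; rewrite bnd_simp.
  rewrite ltNge; apply/negP => ky; suff : x <= y by rewrite leNgt yx.
  by apply: ge_inf; [exact: infS.2 | split=> //; rewrite py (le_trans (ltW yx))].
exists x; last by rewrite px.
split.
  have [e e0 me] := null_left x.
  have xe : (BLeft (x - e) <= BLeft x)%O by rewrite bnd_simp; lra.
  apply: le_lt_trans (le_measure_rayD xe) _; rewrite me adde0.
  apply: le_lt_trans (below (x - e) _); last by lra.
  by apply: le_measure_ray; rewrite bnd_simp.
(* The infimum is not yet known to be attained. Some [y] in [S] lies below [x + e], and the gap []x,
   x + e]] makes the count at [x] at least the count at [y]. *)
have [e e0 me] := null_right x.
have [y [_ ky] yxe] : exists2 y, S y & y < x + e by exact: inf_adherent.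
have xe : (BRight x <= BRight (x + e))%O by rewrite bnd_simp; lra.
apply: le_trans ky _; rewrite -[leRHS]adde0 -me.
apply: le_trans (le_measure_rayD xe).
by apply: le_measure_ray; rewrite bnd_simp ltW.
Qed.

Lemma kth_point_unique (k : nat) (x y : R) :
  is_kth_point m k x -> is_kth_point m k y -> x = y.
Proof.
wlog xy : x y / x <= y => [W kx ky|[_ kx] [yk _]].
  by have [/W->//|/ltW/W->] := leP x y.
apply/eqP; rewrite eq_le xy leNgt /=; apply/negP => ltxy.
have xley : (m `]-oo, x]%classic <= m `]-oo, y[%classic)%E.
  by apply: le_measure_ray; rewrite bnd_simp.
by have := le_lt_trans (le_trans kx xley) yk; rewrite ltxx.
Qed.

Lemma kth_pointE (k : nat) (x : R) : is_kth_point m k x -> kth_point m k = x.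
Proof.
move=> kx; apply: (@kth_point_unique k) => //.
by rewrite /kth_point; case: xgetP => // /(_ x).
Qed.

End LocallyFinite.

(** * Derivatives relative to a closed interval *)

Section DifferentiableOn.
Context {R : realType} (A B : R) (f : R -> R).
Hypothesis df : differentiable_on `[A, B]%classic f.

Lemma differentiable_on_continuous : {within `[A, B]%classic, continuous f}.
Proof.
apply/subspace_continuousP => x Dx.
have /cvg_ex[/= l fl] := df Dx.
have fE y : f y = f x + diff_quotient f x y * (y - x).
  rewrite /diff_quotient; have [->|yx] := eqVneq y x.
    by rewrite !subrr mulr0 addr0.
  by rewrite mulfVK ?subr_eq0// addrC subrK.
apply/cvgrPdist_lt => e e0.
(* Near [x] the quotient is within 1 of its limit [l], so the increment of [f] is at most
   [(|l| + 1) |y - x|]. *)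
have q1 : \forall y \near x, y != x -> `[A, B]%classic y -> `|diff_quotient f x y - l| < 1.
  move/cvgrPdist_lt : fl => /(_ 1 ltr01); rewrite /dnbhs !near_withinE => fl1.
  by near=> y => yx Dy; rewrite distrC; move: yx Dy; near: y; exact: fl1.
have q2 : \forall y \near x, `|x - y| < e / (`|l| + 1).
  by apply: nbhsx_ballx; rewrite divr_gt0// ltr_wpDl.
rewrite near_withinE; near=> y => Dy; rewrite /from_subspace (fE y) opprD addrA subrr sub0r normrN.
have [->|yx] := eqVneq y x; first by rewrite subrr mulr0 normr0.
have d1 : `|diff_quotient f x y - l| < 1 by move: yx Dy; near: y; exact: q1.
rewrite normrM.
apply: (@le_lt_trans _ _ ((`|l| + 1) * `|y - x|)).
  rewrite ler_wpM2r//.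
  by rewrite -lerBlDl (le_trans (lerB_dist _ _))// ltW.
by rewrite mulrC -ltr_pdivlMr ?ltr_wpDl// distrC; near: y; exact: q2.
Unshelve. all: by end_near.
Qed.

(** A neighbourhood of an interior point lies inside the domain, so there the limit within the
    domain is the two-sided limit. *)
Lemma differentiable_on_is_derive x : A < x < B ->
  is_derive x (1 : R) f (derive_on `[A, B]%classic f x).
Proof.
move=> /andP[Ax xB].
have Dx : `[A, B]%classic x by rewrite /= in_itv/= !ltW.
have : diff_quotient f x y @[y --> within `[A, B]%classic x^'] --> derive_on `[A, B]%classic f x.
  exact: df.
set l := derive_on _ _ _ => fl.
have fl' : diff_quotient f x y @[y --> x^'] --> l.
  apply/cvgrPdist_lt => e e0; move/cvgrPdist_lt : fl => /(_ e e0).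
  rewrite /dnbhs !near_withinE => fl.
  have q : \forall y \near x, `]A, B[%classic y.
    by apply: near_in_itvoo; rewrite in_itv/= Ax xB.
  near=> y => yx.
  have : `]A, B[%classic y by near: y; exact: q.
  rewrite /= in_itv/= => /andP[/ltW Ay /ltW yB].
  have : `[A, B]%classic y by rewrite /= in_itv/= Ay yB.
  by move: yx; near: y; exact: fl.
have hl : h^-1 *: ((f \o shift x) (h *: (1 : R)) - f x) @[h --> (0 : R)^'] --> l.
  apply/cvgrPdist_lt => e e0; move/cvgrPdist_lt : fl' => /(_ e e0).
  rewrite /dnbhs /within /= => -[d d0 dl]; exists d => //= h /= hd h0.
  have := dl (h + x); rewrite /diff_quotient /= addrK opprD addrCA subrr addr0 normrN.
  move: hd; rewrite sub0r normrN => hd /(_ hd).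
  rewrite -[X in _ != X]add0r (inj_eq (addIr x)) => /(_ h0).
  by rewrite /GRing.scale/= mulr1 mulrC.
by split; [apply/cvg_ex; exists l | exact: cvg_lim].
Unshelve. all: by end_near.
Qed.

(** By the mean value theorem. This turns a lower bound on [mu'] into a gap between two values of
    [mu]. *)
Lemma differentiable_on_mean_value_le (c x y : R) :
  A < x -> x < y -> y < B ->
  (forall z, x < z < y -> c <= derive_on `[A, B]%classic f z) ->
  c * (y - x) <= f y - f x.
Proof.
move=> Ax xy yB cd.
have [z| |z] := @MVT R f (derive_on `[A, B]%classic f) x y xy.
- rewrite in_itv/= => /andP[xz zy]; apply: differentiable_on_is_derive; lra.
- apply: (@continuous_subspaceW _ _ _ `[A, B]%classic).
    by move=> z /=; rewrite !in_itv/=; lra.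
  exact: differentiable_on_continuous.
- by rewrite in_itv/= => /cd cz ->; rewrite ler_pM2r// subr_gt0.
Qed.

End DifferentiableOn.

(** * Inverse of a continuous increasing function *)

Section IncreasingInverse.
Context {R : realType} (A B : R) (f : R -> R).
Hypothesis AB : A <= B.
Hypothesis finc : strictly_increasing_on `[A, B]%classic f.

Lemma strictly_increasing_on_le x y : A <= x <= B -> A <= y <= B ->
  (f x <= f y) = (x <= y).
Proof.
move=> Dx Dy; apply/idP/idP; last first.
  rewrite le_eqVlt => /predU1P[->//|xy]; apply/ltW/finc => //; by rewrite /= in_itv.
by apply: contraTT; rewrite -!ltNge => yx; apply: finc => //; rewrite /= in_itv.
Qed.

Hypothesis fcont : {within `[A, B]%classic, continuous f}.

(** The intermediate value theorem makes [f] surjective onto [[f A, f B]], and a partial inverse of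
    a surjection is a right inverse with values in the domain. *)
Lemma increasing_pinv k : f A <= k <= f B ->
  A <= pinv `[A, B]%classic f k <= B /\ f (pinv `[A, B]%classic f k) = k.
Proof.
have fsurj : set_surj `[A, B]%classic `[f A, f B]%classic f.
  move=> y /=; rewrite in_itv/= => /andP[Ay yB].
  have fAB : f A <= f B by rewrite (le_trans Ay).
  have [|x xAB <-] := @IVT R f A B y AB fcont.
    by rewrite (min_idPl fAB) (max_idPr fAB) Ay yB.
  by exists x.
move=> kAB; split.
  have := surjpinv_image_sub (dflt:=fun=> point) fsurj.
  by move=> /(_ _ (ex_intro2 _ _ k kAB erefl)); rewrite /= in_itv.
by apply: (surjpK _ fsurj); rewrite inE.
Qed.

End IncreasingInverse.

(** * Measurability of events on point counts *)

Section MeasurablePointCounts.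
Context {R : realType} {d : measure_display} {T : measurableType d}.
Variables (X : R.-ker T ~> measurableTypeR R) (x : R) (c : \bar R).

Lemma measurable_points_below_lt :
  measurable [set w | (X w `]-oo, x[%classic < c)%E].
Proof.
rewrite -[X in measurable X]setTI; apply: measurable_realfun.emeasurable_fun_infty_o => //.
by apply: measurable_kernel; exact: measurable_itv.
Qed.

Lemma measurable_le_npoints :
  measurable [set w | (c <= X w `]-oo, x]%classic)%E].
Proof.
rewrite -[X in measurable X]setTI; apply: measurable_realfun.emeasurable_fun_c_infty => //.
by apply: measurable_kernel; exact: measurable_itv.
Qed.

End MeasurablePointCounts.

(** * The rigidity event expressed through point counts *)

Section RigidityEvent.
Context {R : realType} {d : measure_display} {T : measurableType d}.
Context (X : R.-ker T ~> measurableTypeR R) (A B : R) (mu v : R -> R) (a b t : R).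
Hypothesis Xfin : locally_finite_point_process X.
Hypothesis AB : A <= B.
Hypothesis muinc : strictly_increasing_on `[A, B]%classic mu.
Hypothesis mucont : {within `[A, B]%classic, continuous mu}.
Hypothesis t0 : 0 <= t.
Hypotheses (Aa : mu A <= a) (bB : b <= mu B).
Hypothesis v0 : forall k : R, a < k < b -> 0 < v k.

Let inv := pinv `[A, B]%classic mu.

(* The points of the domain where [mu] is within [t * v k] of [k] form the
   interval [[lower_point k, upper_point k]]. *)
Definition lower_point (k : R) : R := inv (Num.max (mu A) (k - t * v k)).
Definition upper_point (k : R) : R := inv (Num.min (mu B) (k + t * v k)).

(** Clamping at [mu A] keeps the argument of [inv] in the range of [mu], where [inv] is a true right
    inverse; the upper end is respected since [k < b <= mu B] and [t * v k >= 0]. *)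
Lemma lower_pointP k : a < k < b ->
  A <= lower_point k <= B /\
  mu (lower_point k) = Num.max (mu A) (k - t * v k).
Proof.
move=> kab; apply: increasing_pinv => //.
have := mulr_ge0 t0 (ltW (v0 kab)); move: kab => /andP[ak kb] tv.
by rewrite le_max lexx /= ge_max; apply/andP; split; move: Aa bB ak kb tv; lra.
Qed.

Lemma upper_pointP k : a < k < b ->
  A <= upper_point k <= B /\
  mu (upper_point k) = Num.min (mu B) (k + t * v k).
Proof.
move=> kab; apply: increasing_pinv => //.
have := mulr_ge0 t0 (ltW (v0 kab)); move: kab => /andP[ak kb] tv.
by rewrite ge_min lexx /= andbT le_min; apply/andP; split; move: Aa bB ak kb tv; lra.
Qed.

(** Comparisons in the domain are comparisons of values of [mu], and the clamps only restate that
    [x] lies in [[A, B]]. *)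
Lemma lower_upper_pointE k x : a < k < b ->
  (A <= x <= B /\ `|mu x - k| <= t * v k) <->
  lower_point k <= x <= upper_point k.
Proof.
move=> kab; have [lD lE] := lower_pointP kab; have [uD uE] := upper_pointP kab.
have AD : A <= A <= B by rewrite lexx.
have BD : A <= B <= B by rewrite lexx AB.
have muE := strictly_increasing_on_le muinc; split=> [[xD]|/andP[lx xu]].
  rewrite ler_distl => /andP[kx xk].
  rewrite -(muE _ _ lD xD) lE -(muE _ _ xD uD) uE ge_max le_min kx xk.
  by rewrite (muE _ _ AD xD) (muE _ _ xD BD); case/andP: xD => -> ->.
have xD : A <= x <= B.
  by case/andP: lD uD => Al _ /andP[_ uB]; rewrite (le_trans Al)// (le_trans xu).
split=> //; move: lx xu; rewrite -(muE _ _ lD xD) lE -(muE _ _ xD uD) uE.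
by rewrite ge_max le_min ler_distl => /andP[_ ->] /andP[_ ->].
Qed.

Lemma lower_point_le_upper_point k : a < k < b -> lower_point k <= upper_point k.
Proof.
move=> kab; have [lD lE] := lower_pointP kab; have [uD uE] := upper_pointP kab.
rewrite -(strictly_increasing_on_le muinc lD uD) lE uE ge_max !le_min.
have := mulr_ge0 t0 (ltW (v0 kab)); move: kab => /andP[ak kb] tv.
by apply/andP; split; apply/andP; split; move: Aa bB ak kb tv; lra.
Qed.

(** Existence of the [k]-th point in a prescribed interval amounts to two conditions on counts. This
    makes the event measurable and allows a union bound on its complement. *)
Lemma rigidity_eventE :
  rigidity_event X `[A, B]%classic mu v a b t =
  \bigcap_(k in [set k : nat | a < k%:R < b])
    ([set w | (X w `]-oo, lower_point k%:R[%classic < k%:R%:E)%E] `&`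
     [set w | (k%:R%:E <= X w `]-oo, upper_point k%:R]%classic)%E]).
Proof.
apply/seteqP; split=> w /=.
  move=> [kth dev] k /= kab; apply/(kth_point_in_itvP (Xfin w) _ (lower_point_le_upper_point kab)).
  have [x kx Dx] := kth k kab; exists x => //; apply/lower_upper_pointE => //.
  split=> //; rewrite -ler_pdivrMr ?v0// -(kth_pointE kx).
  apply: le_trans dev; rewrite /max_deviation.
  apply: (@le_bigmax_seq _ _ _ _ 0 k (fun k : nat => a < k%:R < b)
    (fun k : nat => `|mu (kth_point (X w) k) - k%:R| / v k%:R)) => //.
  (* From [k < b] follows [k <= truncn b], which is why the maximum runs up to the successor of the
     truncation. *)
  rewrite mem_index_iota /= ltnS; move: kab => /andP[_ kb].
  by rewrite truncn_ge_nat ?(ltW kb)// (le_trans (ler0n _ k) (ltW kb)).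
move=> H.
have kth k : a < k%:R < b -> exists2 x, is_kth_point (X w) k x &
    A <= x <= B /\ `|mu x - k%:R| <= t * v k%:R.
  move=> kab; have pq := lower_point_le_upper_point kab.
  have /(kth_point_in_itvP (Xfin w) _ pq)[x kx lxu] := H k kab.
  by exists x => //; apply/lower_upper_pointE.
split=> [k kab|]; first by have [x kx [xD _]] := kth k kab; exists x.
(* The default value 0 of the maximum is below the level because [0 <= t]. *)
apply: bigmax_le => // k kab; have [x kx [_ xk]] := kth k kab.
by rewrite (kth_pointE kx) ler_pdivrMr ?v0.
Qed.

Lemma measurable_rigidity_event :
  measurable (rigidity_event X `[A, B]%classic mu v a b t).
Proof.
rewrite rigidity_eventE; apply: bigcap_measurableType => k _.
by apply: measurableI; [exact: measurable_points_below_lt|exact: measurable_le_npoints].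
Qed.

End RigidityEvent.

(** * Exponential Markov inequality *)

Import HBNNSimple.

Section Chernoff.
Context {R : realType} {d : measure_display} {T : measurableType d}.

(* The integral is the supremum over the nonnegative simple functions below [f],
   one of which is [c] times the indicator of [E]; this avoids proving that
   [expeR] is measurable. *)
Lemma cst_mul_measure_le_integral (m : {measure set T -> \bar R})
    (E : set T) (c : R) (f : T -> \bar R) :
  measurable E -> 0 <= c -> (forall x, (0 <= f x)%E) ->
  (forall x, E x -> (c%:E <= f x)%E) ->
  (c%:E * m E <= \int[m]_x f x)%E.
Proof.
move=> mE c0 f0 cf; rewrite ge0_integralTE//.
apply: ereal_sup_ubound; exists (scale_nnsfun (indic_nnsfun R mE) c0).
  move=> x; rewrite /= -[X in X%:E]/(c * \1_E x) indicE; have [|] := boolP (x \in E).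
    by rewrite inE => /cf; rewrite mulr1.
  by rewrite mulr0.
by rewrite sintegralrM sintegral_indic.
Qed.

(** On [E] the integrand is at least [expR s]. The sign of [gamma] is free, so the same inequality
    serves both tails. *)
Lemma exponential_markov (P : probability T R) (E : set T) (N : T -> \bar R)
    (gamma s B : R) :
  measurable E -> (forall w, E w -> (s%:E <= gamma%:E * N w)%E) ->
  (\int[P]_w expeR (gamma%:E * N w) <= B%:E)%E ->
  (P E <= (B * expR (- s))%:E)%E.
Proof.
move=> mE Es hB.
have := @cst_mul_measure_le_integral P E (expR s) (fun w => expeR (gamma%:E * N w)) mE.
move=> /(_ (expR_ge0 _) (fun=> expeR_ge0 _)) h.
have {}h : ((expR s)%:E * P E <= B%:E)%E.
  by apply: le_trans hB; apply: h => w /Es sN; rewrite -[(expR s)%:E]/(expeR s%:E) lee_expeR.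
have PE : P E \is a fin_num by rewrite fin_num_measure.
rewrite -(fineK PE) -EFinM !lee_fin in h *.
by rewrite expRN ler_pdivlMr ?expR_gt0// mulrC.
Qed.

End Chernoff.

(** * Negative powers and the tails of their sums *)

Section PowerDecay.
Context {R : realType}.
Implicit Types (eps x y m : R).

Lemma powR_expE x y : 0 < x -> x `^ y = expR (y * ln x).
Proof. by move=> x0; rewrite /powR gt_eqF. Qed.

Lemma ler_powRN eps x y : 0 <= eps -> 0 < x -> x <= y ->
  y `^ (- eps) <= x `^ (- eps).
Proof.
move=> e0 x0 xy; have y0 := lt_le_trans x0 xy.
by rewrite !powR_expE// ler_expR !mulNr lerN2 ler_wpM2l// ler_ln.
Qed.

(** This replaces the comparison of a term with the integral of [u^-(1+eps)] over [[x - 1, x]]: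
    combine [ln (1 - 1/x) <= - 1/x] with [1 + y <= exp y] at [y = eps / x]. *)
Lemma powR_le_difference eps x : 0 < eps -> 1 < x ->
  x `^ (- (1 + eps)) <= ((x - 1) `^ (- eps) - x `^ (- eps)) / eps.
Proof.
move=> e0 x1; have x0 : 0 < x by lra.
have x10 : 0 < x - 1 by lra.
rewrite ler_pdivlMr// !powR_expE//.
have -> : - (1 + eps) * ln x = - eps * ln x - ln x by ring.
rewrite expRD expRN lnK ?posrE//.
have ix : 0 < 1 - x^-1 by rewrite subr_gt0 invf_lt1.
have lnx : ln (x - 1) <= ln x - x^-1.
  have -> : x - 1 = x * (1 - x^-1) by rewrite mulrBr mulr1 divff// gt_eqF.
  rewrite lnM ?posrE// lerD2l; apply: le_ln1Dx; lra.
have : expR (- eps * ln x) * (1 + eps / x) <= expR (- eps * ln (x - 1)).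
  apply: le_trans (_ : expR (- eps * ln x) * expR (eps / x) <= _).
    by rewrite ler_pM2l ?expR_gt0// expR_ge1Dx.
  rewrite -expRD ler_expR.
  have := ler_wpM2l (ltW e0) lnx; rewrite mulrBr; lra.
by rewrite mulrDr mulr1 mulrA; lra.
Qed.

Lemma sum_powR_tail eps m (n : nat) : 0 < eps -> 0 < m ->
  \sum_(k < n | m + 1 <= k%:R) k%:R `^ (- (1 + eps)) <= m `^ (- eps) / eps.
Proof.
move=> e0 m_gt0.
have maxm x : 0 < Num.max m x by rewrite lt_max m_gt0.
(* Strengthened to a telescoping bound for the induction. The maximum with [m] covers the [n] for
   which the sum is still empty. *)
suff H : \sum_(k < n | m + 1 <= k%:R) k%:R `^ (- (1 + eps)) <=
    (m `^ (- eps) - (Num.max m (n%:R - 1)) `^ (- eps)) / eps.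
  apply: (le_trans H); rewrite ler_pM2r ?invr_gt0//.
  by rewrite lerBlDr lerDl powR_ge0.
elim: n => [|n IHn].
  by rewrite big_ord0 sub0r (max_idPl _) ?subrr ?mul0r//; lra.
rewrite big_mkcond big_ord_recr -big_mkcond /=.
have nE : n.+1%:R - 1 = n%:R :> R by rewrite -natr1 addrK.
rewrite nE; case: ifPn => [mn|_].
  have n1 : 1 < n%:R :> R by lra.
  have -> : Num.max m n%:R = n%:R by apply/max_idPr; lra.
  have E : Num.max m (n%:R - 1) = n%:R - 1 by apply/max_idPr; lra.
  rewrite E in IHn.
  have := lerD IHn (powR_le_difference e0 n1).
  by rewrite -mulrDl addrA subrK.
rewrite addr0; apply: (le_trans IHn); rewrite ler_pM2r ?invr_gt0// lerD2l lerN2.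
apply: ler_powRN => //; first exact: ltW.
by rewrite ge_max !le_max lexx /=; apply/orP; right; lra.
Qed.

Lemma cvg_powRN_pinfty (f : R -> R) (s : R) : 0 < s ->
  f r @[r --> +oo] --> +oo -> f r `^ (- s) @[r --> +oo] --> 0.
Proof.
move=> s0 foo; apply/cvgrPdist_le => e e0.
(* The threshold is [e^(-1/s)], the value whose power [-s] is [e]. *)
move/cvgryPge : foo => /(_ (expR (- ln e / s))).
apply: filterS => r fr; have f0 : 0 < f r by apply: lt_le_trans fr; exact: expR_gt0.
rewrite sub0r normrN ger0_norm ?powR_ge0// powR_expE// -[leRHS]lnK ?posrE// ler_expR.
have := fr; rewrite -[X in _ <= X]lnK ?posrE// ler_expR ler_pdivrMr//.
by rewrite mulNr lerNl mulrC.
Qed.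

End PowerDecay.

(** * Consequences of logarithmic growth of the variance *)

Section Estimates.
Context {R : realType}.
Implicit Types (a eps t K M k : R).

(** The exponent is [(1 + eps) v / a], and [v / a >= ln k - K / a]. The assumption [eps <= 1]
    replaces [(1 + eps) K / a] by [2 K / a], so that the constant does not depend on [eps]. *)
Lemma gaussian_tail_le a eps t K k v : 0 < a -> 0 < eps -> eps <= 1 ->
  t ^+ 2 = 2 / a * (1 + eps) -> 0 <= K -> 0 < k -> a * ln k - K <= v ->
  expR (- (t ^+ 2 / 2 * v)) <= expR (2 * K / a) * k `^ (- (1 + eps)).
Proof.
move=> a0 e0 e1 tE K0 k0 hv; rewrite powR_expE// -expRD ler_expR tE.
have -> : 2 / a * (1 + eps) / 2 * v = (1 + eps) * (v / a) by field; lra.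
have hva : ln k - K / a <= v / a.
  by rewrite ler_pdivlMr// mulrBl divfK ?gt_eqF// mulrC.
have Ka : 0 <= K / a by rewrite divr_ge0// ltW.
have := ler_wpM2l (_ : 0 <= 1 + eps) hva.
have eKa : eps * (K / a) <= 1 * (K / a) by rewrite ler_wpM2r.
rewrite -(mulrA 2 K); move: (v / a) (K / a) (ln k) Ka eKa => x y l Ka eKa h.
have := h (ltac:(lra)); nra.
Qed.

(** Here [w] stands for the value of the variance at [k + t * v]. Since [ln k <= k] and [1 <= k],
    the ratio [v / k] is at most [a + K]; hence [ln (k + t * v) <= ln k + t * (v / k)] exceeds
    [ln k] by a bounded amount only. *)
Lemma log_growth_increment a t K M k v w : 0 < a -> 0 <= K -> 0 <= t -> t <= M ->
  1 <= k -> 0 <= v -> `|v - a * ln k| <= K -> w - a * ln (k + t * v) <= K ->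
  w <= v + (2 * K + a * M * (a + K)).
Proof.
move=> a0 K0 t0 tM k1 v0; rewrite ler_norml => /andP[Kv vK] wK.
have k0 : 0 < k by lra.
have vk : v / k <= a + K.
  rewrite ler_pdivrMr//; have := ln_sublinear k0 => lnk.
  have h1 : a * ln k <= a * k by rewrite ler_wpM2l// ltW.
  have h2 : K * 1 <= K * k by rewrite ler_wpM2l.
  by rewrite mulrDl; lra.
have vk0 : 0 <= v / k by rewrite divr_ge0// ltW.
have tvk : t * (v / k) <= M * (a + K) by rewrite ler_pM.
have tvk0 : 0 <= t * (v / k) by rewrite mulr_ge0.
have lnE : ln (k + t * v) <= ln k + t * (v / k).
  have -> : k + t * v = k * (1 + t * (v / k)) by field; lra.
  rewrite lnM ?posrE//; last by lra.
  by rewrite lerD2l; apply: le_ln1Dx; lra.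
have h : a * ln (k + t * v) <= a * (ln k + M * (a + K)).
  by rewrite ler_wpM2l ?(ltW a0)//; lra.
by move: h; rewrite mulrDr mulrA; lra.
Qed.

End Estimates.

(** * The probability bound for one fixed process *)

(* [x1 < x2 < x3] and [y3 < y2 < y1] stand for [(eta1 + c delta) r] and
   [(eta2 - c delta) r] with [c = 1/2, 1, 2], and [h] for [delta r]. *)
Section RigidityBound.
Context {R : realType} {d : measure_display} {T : measurableType d}.
Context (P : probability T R) (X : R.-ker T ~> measurableTypeR R).
Context (a M C K h A x1 x2 x3 y3 y2 y1 B : R) (mu sigma : R -> R).
Hypothesis Xfin : locally_finite_point_process X.
Hypotheses (Ax1 : A < x1) (x12 : x1 < x2) (x23 : x2 < x3) (x3y3 : x3 < y3)
  (y32 : y3 < y2) (y21 : y2 < y1) (y1B : y1 < B).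
Hypotheses (x23E : x3 - x2 = h) (y32E : y2 - y3 = h).
Hypotheses (a0 : 0 < a) (M0 : 0 < M) (C0 : 0 < C) (K0 : 0 <= K).
Hypothesis muinc : strictly_increasing_on `[A, B]%classic mu.
Hypothesis mudiff : differentiable_on `[A, B]%classic mu.
Hypothesis sigma0 : forall x, A <= x <= B -> 0 <= sigma x.
Hypothesis sigmainc : strictly_increasing_on `[A, B]%classic sigma.

Let inv := pinv `[A, B]%classic mu.
Let v := sq_comp_inv `[A, B]%classic sigma mu.

Hypothesis vlog : forall k, mu x1 <= k <= mu y1 -> `|v k - a * ln k| <= K.
Hypothesis expmom : forall gamma x, - M <= gamma <= M -> x1 < x < y1 ->
  (\int[P]_w expeR (gamma%:E * npoints_le (X w) x) <=
   (C * expR (gamma * mu x + gamma ^+ 2 / 2 * sigma x ^+ 2))%:E)%E.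
Hypothesis slope : forall x z, x1 < x < y1 -> x1 < z < y1 ->
  (M + 1) * sigma z ^+ 2 <= h * derive_on `[A, B]%classic mu x.
Hypotheses (mux2 : 1 <= mu x2) (sigmax2 : 1 <= sigma x2).

Let mucont : {within `[A, B]%classic, continuous mu}.
Proof. exact: differentiable_on_continuous. Qed.

Let h0 : 0 < h. Proof. by rewrite -x23E subr_gt0. Qed.

(** The slope hypothesis bounds [mu'] below by [(M + 1) sigma(z)^2 / h], and the interval has length
    [h]. *)
Let gap u w z : x1 < u -> u < w -> w < y1 -> w - u = h ->
  x1 < z < y1 -> (M + 1) * sigma z ^+ 2 <= mu w - mu u.
Proof.
move=> xu uw wy wuE zr.
have := @differentiable_on_mean_value_le _ A B mu mudiff
  ((M + 1) * sigma z ^+ 2 / h) u w.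
rewrite wuE divfK ?gt_eqF//; apply => //; first exact: lt_trans xu.
  exact: lt_trans y1B.
move=> x /andP[ux xw]; rewrite ler_pdivrMr// [leRHS]mulrC; apply: slope => //.
by rewrite (lt_trans xu)// (lt_trans xw).
Qed.

Let x2y1 : x2 < y1. Proof. by move: x23 x3y3 y32 y21; lra. Qed.
Let x3y1 : x3 < y1. Proof. by move: x3y3 y32 y21; lra. Qed.
Let x1y3 : x1 < y3. Proof. by move: x12 x23 x3y3; lra. Qed.

Let gapM u w z : x1 < u -> u < w -> w < y1 -> w - u = h ->
  x1 < z < y1 -> M * sigma z ^+ 2 <= mu w - mu u.
Proof.
move=> xu uw wy wuE zr; apply: le_trans (gap xu uw wy wuE zr).
by rewrite ler_wpM2r ?sqr_ge0// lerDl.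
Qed.

Let gapx z : x1 < z < y1 -> M * sigma z ^+ 2 <= mu x3 - mu x2.
Proof. exact: gapM. Qed.

Let gapy z : x1 < z < y1 -> M * sigma z ^+ 2 <= mu y2 - mu y3.
Proof. exact: gapM. Qed.

(** The [1] in the factor [M + 1] is spent here, with [sigma x2 >= 1]. The unit of room lets the
    tail sum start at [mu x2 + 1]. *)
Let mux3 : mu x2 + 1 <= mu x3.
Proof.
have x2r : x1 < x2 < y1 by rewrite x12.
have := gap x12 x23 x3y1 x23E x2r.
have : 1 <= sigma x2 ^+ 2.
  by rewrite -(expr1n _ 2) ler_pXn2r ?nnegrE// (le_trans ler01).
by move=> s2; have := mulr_ge0 (ltW M0) (le_trans ler01 s2); move: s2; rewrite mulrDl; lra.
Qed.

Let inD x : x1 <= x <= y1 -> A <= x <= B.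
Proof. by move: Ax1 y1B => *; apply/andP; split; lra. Qed.

Let AB : A <= B. Proof. by move: Ax1 x12 x23 x3y3 y32 y21 y1B; lra. Qed.

Let mu_lt x y : A <= x <= B -> A <= y <= B -> (mu x < mu y) = (x < y).
Proof. by move=> xD yD; rewrite !ltNge (strictly_increasing_on_le muinc). Qed.

Let x1D : A <= x1 <= B.
Proof. by apply: inD; rewrite lexx; move: x12 x23 x3y3 y32 y21; lra. Qed.
Let x2D : A <= x2 <= B.
Proof. by apply: inD; apply/andP; split; move: x12 x23 x3y3 y32 y21; lra. Qed.
Let x3D : A <= x3 <= B.
Proof. by apply: inD; apply/andP; split; move: x12 x23 x3y3 y32 y21; lra. Qed.
Let y1D : A <= y1 <= B.
Proof. by apply: inD; rewrite lexx andbT; move: x12 x23 x3y3 y32 y21; lra. Qed.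
Let y2D : A <= y2 <= B.
Proof. by apply: inD; apply/andP; split; move: x12 x23 x3y3 y32 y21; lra. Qed.
Let y3D : A <= y3 <= B.
Proof. by apply: inD; apply/andP; split; move: x12 x23 x3y3 y32 y21; lra. Qed.

Let AD : A <= A <= B. Proof. by rewrite lexx AB. Qed.
Let BD : A <= B <= B. Proof. by rewrite lexx AB. Qed.

Let muE := strictly_increasing_on_le muinc.

Lemma mu_range_pinv k : mu x1 < k < mu y1 ->
  x1 < inv k < y1 /\ mu (inv k) = k.
Proof.
move=> /andP[xk ky]; have muAx : mu A <= mu x1 by rewrite muE//; exact: ltW.
have muyB : mu y1 <= mu B by rewrite muE//; exact: ltW.
have [kD kE] : A <= inv k <= B /\ mu (inv k) = k.
  by apply: increasing_pinv => //; apply/andP; split;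
    move: muAx muyB xk ky; lra.
by split=> //; rewrite -(mu_lt x1D kD) -(mu_lt kD y1D) kE xk ky.
Qed.

Let mux12 : mu x1 < mu x2. Proof. by rewrite mu_lt. Qed.
Let mux23 : mu x2 < mu x3. Proof. by rewrite mu_lt. Qed.
Let muy32 : mu y3 < mu y2. Proof. by rewrite mu_lt. Qed.
Let muy21 : mu y2 < mu y1. Proof. by rewrite mu_lt. Qed.

(** [sigma] is nonnegative at [A] and strictly increasing, hence positive at [inv k > A]. *)
Lemma sq_comp_inv_gt0 k : mu x1 < k < mu y1 -> 0 < v k.
Proof.
move=> /mu_range_pinv[/andP[xk ky] _]; rewrite exprn_gt0//.
have kD : A <= inv k <= B by apply: inD; rewrite !ltW.
apply: (le_lt_trans (sigma0 AD)); apply: sigmainc; rewrite /= ?in_itv//=.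
exact: lt_trans xk.
Qed.

Lemma le_sq_comp_inv j k : mu x1 < j -> j <= k -> k < mu y1 -> v j <= v k.
Proof.
move=> xj jk ky.
have [/andP[xj' jy'] jE] : x1 < inv j < y1 /\ mu (inv j) = j.
  by apply: mu_range_pinv; rewrite xj (le_lt_trans jk).
have [/andP[xk' ky'] kE] : x1 < inv k < y1 /\ mu (inv k) = k.
  by apply: mu_range_pinv; rewrite ky (lt_le_trans xj).
have jD : A <= inv j <= B by apply: inD; rewrite !ltW.
have kD : A <= inv k <= B by apply: inD; rewrite !ltW.
rewrite ler_pXn2r ?nnegrE ?sigma0//.
by rewrite (strictly_increasing_on_le sigmainc)// -(muE jD kD) jE kE.
Qed.

Let k_range k : mu x3 < k < mu y3 -> mu x1 < k < mu y1.
Proof.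
by move=> /andP[xk ky]; apply/andP; split; move: mux12 mux23 muy32 muy21 xk ky; lra.
Qed.

Let muAx3 : mu A <= mu x3. Proof. by rewrite muE//; case/andP: x3D. Qed.
Let muyB3 : mu y3 <= mu B. Proof. by rewrite muE//; case/andP: y3D. Qed.

Lemma measurable_rigidity t : 0 <= t ->
  measurable (rigidity_event X `[A, B]%classic mu v (mu x3) (mu y3) t).
Proof.
move=> t0; apply: measurable_rigidity_event => //.
by move=> k /k_range/sq_comp_inv_gt0.
Qed.

Section FixedLevel.
Variables (t eps : R).
Hypotheses (t0 : 0 < t) (tM : t <= M) (eps0 : 0 < eps) (eps1 : eps <= 1).
Hypothesis tE : t ^+ 2 = 2 / a * (1 + eps).

Let K1 := 2 * K + a * M * (a + K).

(** The term with [K1] pays for a variance exceeding [v k] by up to [K1], using [t <= M]; the term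
    [2 * K / a] comes from [gaussian_tail_le]. *)
Let tailC := C * expR (M ^+ 2 / 2 * K1 + 2 * K / a).

Let lo := lower_point A B mu v t.
Let up := upper_point A B mu v t.

(** The shift is at most [M * v k], that is [M * sigma z ^+ 2] at [z = inv k], which [gapx] and
    [gapy] bound by the increments of [mu] over [[x2, x3]] and [[y3, y2]]. *)
Lemma shift_in_range k : mu x3 < k < mu y3 ->
  mu x2 < k - t * v k /\ k + t * v k < mu y2.
Proof.
move=> /andP[xk ky].
have [zr _] : x1 < inv k < y1 /\ mu (inv k) = k.
  by apply: mu_range_pinv; apply/andP; split; move: mux12 mux23 muy32 muy21 xk ky; lra.
have vk0 : 0 <= v k by exact: sqr_ge0.
have tv : t * v k <= M * v k by rewrite ler_wpM2r.
have gx : M * v k <= mu x3 - mu x2 := gapx zr.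
have gy : M * v k <= mu y2 - mu y3 := gapy zr.
by split; move: xk ky tv gx gy; lra.
Qed.

Let K1_ge0 : 0 <= K1.
Proof.
by rewrite addr_ge0 ?mulr_ge0 ?addr_ge0// ?(ltW a0)// (le_trans (ltW t0)).
Qed.

(** [u] is the variance at the shifted point. With [u <= v k + K1] the exponent is at most
    [- t^2 v(k) / 2 + t^2 K1 / 2]. *)
Lemma chernoff_exponent_le k u : mu x3 < k < mu y3 -> u <= v k + K1 ->
  C * expR (- (t ^+ 2 * v k) + t ^+ 2 / 2 * u) <= tailC * k `^ (- (1 + eps)).
Proof.
move=> kr uv; have kr1 := k_range kr; have vk0 := sq_comp_inv_gt0 kr1.
have k0 : 0 < k.
  by case/andP: kr => xk _; move: xk mux2 mux23; lra.
have vk : a * ln k - K <= v k.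
  have : `|v k - a * ln k| <= K by apply: vlog; case/andP: kr1 => *; rewrite !ltW.
  by rewrite ler_norml => /andP[vK _]; move: vK; lra.
have tail := gaussian_tail_le a0 eps0 eps1 tE K0 k0 vk.
have tM2 : t ^+ 2 / 2 * K1 <= M ^+ 2 / 2 * K1.
  by rewrite ler_wpM2r// ler_wpM2r// ler_pXn2r ?nnegrE ?(ltW t0)// (le_trans (ltW t0)).
have tu : t ^+ 2 / 2 * u <= t ^+ 2 / 2 * (v k + K1).
  by rewrite ler_wpM2l// divr_ge0// sqr_ge0.
rewrite /tailC -[leRHS]mulrA ler_pM2l//.
apply: (@le_trans _ _ (expR (M ^+ 2 / 2 * K1 - t ^+ 2 / 2 * v k))).
  by rewrite ler_expR; move: tu tM2; rewrite mulrDr; lra.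
rewrite expRD (expRD (M ^+ 2 / 2 * K1) (2 * K / a)) -[leRHS]mulrA.
by rewrite ler_pM2l ?expR_gt0.
Qed.

Lemma lower_tail k : mu x3 < k%:R < mu y3 ->
  (P (~` [set w | (X w `]-oo, lo k%:R[%classic < k%:R%:E)%E]) <=
   (tailC * k%:R `^ (- (1 + eps)))%:E)%E.
Proof.
move=> kr; have [sx sy] := shift_in_range kr.
have v0 := sq_comp_inv_gt0 (k_range kr); set vk := v k%:R in sx sy v0.
have tv0 : 0 < t * vk by rewrite mulr_gt0.
have jr : mu x1 < k%:R - t * vk < mu y1.
  by case/andP: kr => *; apply/andP; split; move: sx sy mux12 muy21; lra.
have [lr muE'] := mu_range_pinv jr.
(* The clamp at [mu A] is inactive, because the shifted value stays above [mu x2]. *)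
have loE : lo k%:R = inv (k%:R - t * vk).
  rewrite /lo /lower_point (max_idPr _)//.
  have muAx : mu A <= mu x1 by rewrite muE//; exact: ltW.
  by move: muAx sx mux12; rewrite -/vk; lra.
rewrite loE; set p := inv _ in lr muE' *.
have tr : - M <= t <= M by rewrite tM andbT; move: t0 tM; lra.
apply: le_trans (exponential_markov (s := t * k%:R) _ _ (expmom tr lr)) _.
- by apply: measurableC; exact: measurable_points_below_lt.
(* On the complement at least [k] points lie in []-oo, p[], hence in []-oo, p]]. *)
- move=> w /= /negP; rewrite -leNgt => kX.
  rewrite EFinM lee_pmul2l// ?lte_fin//; apply: le_trans kX _.
  by apply: le_measure_ray; rewrite bnd_simp.
(* The shift is to the left, so monotonicity alone bounds the variance. *)
have vp : sigma p ^+ 2 <= vk.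
  apply: (@le_sq_comp_inv (k%:R - t * vk) k%:R).
  - by case/andP: jr.
  - by rewrite lerBlDr lerDl ltW.
  - by case/andP: (k_range kr).
rewrite lee_fin -mulrA -expRD.
apply: le_trans (chernoff_exponent_le kr (u := sigma p ^+ 2) _); last first.
  by rewrite (le_trans vp)// lerDl.
by rewrite ler_pM2l// ler_expR muE' -/vk; lra.
Qed.

Lemma upper_tail k : mu x3 < k%:R < mu y3 ->
  (P (~` [set w | (k%:R%:E <= X w `]-oo, up k%:R]%classic)%E]) <=
   (tailC * k%:R `^ (- (1 + eps)))%:E)%E.
Proof.
move=> kr; have [sx sy] := shift_in_range kr.
have v0 := sq_comp_inv_gt0 (k_range kr); set vk := v k%:R in sx sy v0.
have tv0 : 0 < t * vk by rewrite mulr_gt0.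
have jr : mu x1 < k%:R + t * vk < mu y1.
  by case/andP: kr => *; apply/andP; split; move: sx sy mux12 muy21; lra.
have [lr muE'] := mu_range_pinv jr.
have upE : up k%:R = inv (k%:R + t * vk).
  rewrite /up /upper_point (min_idPr _)//.
  have muyB : mu y1 <= mu B by rewrite muE//; exact: ltW.
  by move: muyB sy muy21; rewrite -/vk; lra.
rewrite upE; set p := inv _ in lr muE' *.
have tr : - M <= - t <= M by rewrite lerN2 tM; move: t0 tM; lra.
apply: le_trans (exponential_markov (s := - t * k%:R) _ _ (expmom tr lr)) _.
- by apply: measurableC; exact: measurable_le_npoints.
- move=> w /= /negP; rewrite -ltNge => kX.
  by rewrite EFinM !EFinN !mulNe leeN2 lee_pmul2l// ?lte_fin// ltW.
have k1 : 1 <= k%:R :> R by case/andP: kr => xk _; move: xk mux2 mux23; lra.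
(* The shift is to the right, so monotonicity goes the wrong way; the logarithmic bound is applied
   at [k] and at [k + t * vk] instead. *)
have vp : sigma p ^+ 2 <= vk + K1.
  have kr1 := k_range kr.
  apply: (log_growth_increment a0 K0 (ltW t0) tM k1 (ltW v0)).
    by apply: vlog; case/andP: kr1 => *; rewrite !ltW.
  have : `|sigma p ^+ 2 - a * ln (k%:R + t * vk)| <= K.
    by apply: vlog; case/andP: jr => *; rewrite !ltW.
  by rewrite ler_norml => /andP[].
rewrite lee_fin -mulrA -expRD.
apply: le_trans (chernoff_exponent_le kr (u := sigma p ^+ 2) vp).
by rewrite ler_pM2l// ler_expR muE' -/vk sqrrN; lra.
Qed.

Lemma rigidity_bound :
  ((1 - 2 * tailC * (mu x2 `^ (- eps) / eps))%:E <=
   P (rigidity_event X `[A, B]%classic mu v (mu x3) (mu y3) t))%E.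
Proof.
have vgt0 k : mu x3 < k < mu y3 -> 0 < v k by move=> /k_range/sq_comp_inv_gt0.
have mE : measurable (rigidity_event X `[A, B]%classic mu v (mu x3) (mu y3) t).
  by apply: measurable_rigidity; exact: ltW.
suff H : (P (~` rigidity_event X `[A, B]%classic mu v (mu x3) (mu y3) t) <=
    (2 * tailC * (mu x2 `^ (- eps) / eps))%:E)%E.
  rewrite -[X in P X]setCK probability_setC; last exact: measurableC.
  by rewrite EFinB leeB.
have tailC0 : 0 < tailC by rewrite mulr_gt0// expR_gt0.
(* [F k] is the failure at [k], empty out of range, so that a finite union up to the truncation of
   [mu y3] covers the complement. *)
pose F (k : nat) := if mu x3 < k%:R < mu y3 then
  ~` [set w | (X w `]-oo, lo k%:R[%classic < k%:R%:E)%E] `|`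
  ~` [set w | (k%:R%:E <= X w `]-oo, up k%:R]%classic)%E] else set0.
have mF k : measurable (F k).
  rewrite /F; case: ifPn => // _; apply: measurableU; apply: measurableC.
    exact: measurable_points_below_lt.
  exact: measurable_le_npoints.
pose n := (Num.truncn (mu y3)).+1.
apply: (@le_trans _ _ (P (\big[setU/set0]_(k < n) F k))).
  apply: le_measure; rewrite ?inE.
  - exact: measurableC.
  - by apply: bigsetU_measurable => k _.
  rewrite rigidity_eventE//; last exact: ltW.
  rewrite setC_bigcap -bigcup_mkord => w [k /= kr nk]; exists k; last first.
    by rewrite /F kr -setCI.
  rewrite /= /n ltnS; case/andP: kr => _ ky.
  by rewrite truncn_ge_nat ?(ltW ky)// (le_trans (ler0n _ k) (ltW ky)).
apply: (le_trans (Boole_inequality P (fun i _ => mF i))).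
(* By [mux3] every index in range is at least [mu x2 + 1], the form required by [sum_powR_tail]; the
   extra terms are nonnegative. *)
apply: (@le_trans _ _ (\sum_(k < n) (if mu x2 + 1 <= k%:R then
    2 * tailC * k%:R `^ (- (1 + eps)) else 0)%:E)).
  apply: lee_sum => k _; rewrite /F; case: ifPn => [kr|_].
    have -> : mu x2 + 1 <= k%:R by case/andP: kr => xk _; move: xk mux3; lra.
    apply: le_trans (measureU2 _ _ _) _.
    - by apply: measurableC; exact: measurable_points_below_lt.
    - by apply: measurableC; exact: measurable_le_npoints.
    apply: le_trans (leeD (lower_tail kr) (upper_tail kr)) _.
    by rewrite -EFinD lee_fin; lra.
  rewrite measure0 lee_fin; case: ifPn => // _.
  by rewrite mulr_ge0 ?powR_ge0// mulr_ge0// ltW.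
rewrite sumEFin lee_fin -big_mkcond /= -mulr_sumr ler_pM2l; last exact: mulr_gt0.
by apply: sum_powR_tail => //; move: mux2; lra.
Qed.

End FixedLevel.
End RigidityBound.

(** * Uniformity in [r] and passage to the limit *)

Theorem theorem1p10 (R : realType)
  (d : R -> measure_display) (T : forall r : R, measurableType (d r))
  (P : forall r : R, probability (T r) R)
  (X : forall r : R, R.-ker (T r) ~> measurableTypeR R)
  (hX : forall r, 0 <= r -> locally_finite_point_process (X r))
  (hXmin : forall r, 0 <= r -> {ae P r, forall w, has_smallest_point (X r w)})
  (a M C r0 : R) (eta1 eta2 delta : R -> R) (mu sigma : R -> R -> R)
  (ha : 0 < a) (hM : Num.sqrt (2 / a) < M) (hC : 0 < C) (hr0 : 0 < r0)
  (heta : forall r, r0 <= r -> 0 < eta1 r /\ eta1 r < eta2 r)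
  (hdelta : forall r, r0 <= r -> 0 < delta r < (eta2 r - eta1 r) / 5)
  (hmu0 : forall r, r0 <= r ->
    forall x, x \in `[eta1 r * r, eta2 r * r] -> 0 <= mu r x)
  (hsigma0 : forall r, r0 <= r ->
    forall x, x \in `[eta1 r * r, eta2 r * r] -> 0 <= sigma r x)
  (hexp : forall gamma x r, r0 < r -> gamma \in `[- M, M] ->
    x \in `]eta1 r + delta r / 2, eta2 r - delta r / 2[ ->
    (\int[P r]_w expeR (gamma%:E * npoints_le (X r w) (x * r)) <=
     (C * expR (gamma * mu r (x * r)
                + gamma ^+ 2 / 2 * sigma r (x * r) ^+ 2))%:E)%E)
  (hmu_incr : forall r, r0 < r ->
    strictly_increasing_on `[eta1 r * r, eta2 r * r]%classic (mu r))
  (hsigma_incr : forall r, r0 < r ->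
    strictly_increasing_on `[eta1 r * r, eta2 r * r]%classic (sigma r))
  (hmu_diff : forall r, r0 < r ->
    differentiable_on `[eta1 r * r, eta2 r * r]%classic (mu r))
  (hsigma_diff : forall r, r0 < r ->
    differentiable_on `[eta1 r * r, eta2 r * r]%classic (sigma r))
  (hmu_lim : mu r ((eta1 r + delta r) * r) @[r --> +oo] --> +oo)
  (hsigma_lim : sigma r ((eta1 r + delta r) * r) @[r --> +oo] --> +oo)
  (hxmu' : forall r, r0 < r ->
    nondecreasing_on `[eta1 r * r, eta2 r * r]%classic
      (fun x => x * derive_on `[eta1 r * r, eta2 r * r]%classic (mu r) x))
  (hinf :
    ereal_inf
      [set (delta r * r
             * derive_on `[eta1 r * r, eta2 r * r]%classic (mu r) (x * r)
             / sigma r (y * r) ^+ 2)%:E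
        | x in `]eta1 r + delta r / 2, eta2 r - delta r / 2[%classic
        & y in `]eta1 r + delta r / 2, eta2 r - delta r / 2[%classic]
      @[r --> +oo] --> +oo%E)
  (hconc : forall r, r0 < r ->
    strictly_concave_on `[mu r (eta1 r * r), mu r (eta2 r * r)]%classic
      (sq_comp_inv `[eta1 r * r, eta2 r * r]%classic (sigma r) (mu r)))
  (hincr : forall r, r0 < r ->
    strictly_increasing_on `[mu r (eta1 r * r), mu r (eta2 r * r)]%classic
      (sq_comp_inv `[eta1 r * r, eta2 r * r]%classic (sigma r) (mu r)))
  (hlog : exists K : R, \forall r \near +oo,
    forall k, k \in `[mu r ((eta1 r + delta r / 2) * r),
                      mu r ((eta2 r - delta r / 2) * r)] ->
    `|sq_comp_inv `[eta1 r * r, eta2 r * r]%classic (sigma r) (mu r) k - a * ln k|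
      <= K)
  (hbd1 : exists2 e : R, 0 < e & \forall r \near +oo, e <= eta1 r + delta r)
  (hbd2 : exists2 e : R, 0 < e &
    \forall r \near +oo, e <= eta2 r - eta1 r - 4 * delta r)
  (hbd3 : exists K : R, \forall r \near +oo, eta2 r <= K)
  (lambda : R) (hlambda : 1 < lambda) :
  let rigid (r t : R) : set (T r) :=
    rigidity_event (X r) `[eta1 r * r, eta2 r * r]%classic (mu r)
      (sq_comp_inv `[eta1 r * r, eta2 r * r]%classic (sigma r) (mu r))
      (mu r ((eta1 r + 2 * delta r) * r))
      (mu r ((eta2 r - 2 * delta r) * r)) t in
  (exists c r0' : R, [/\ 0 < c, 0 < r0' &
    exists2 eps0 : R, 0 < eps0 &
      forall eps r, 0 < eps < eps0 -> r0' <= r ->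
      ((1 - c * mu r ((eta1 r + delta r) * r) `^ (- (eps / lambda)) / eps)%:E
        <= P r (rigid r (Num.sqrt (2 / a * (1 + eps)))))%E])
  /\ (forall eps : R, 0 < eps ->
       P r (rigid r (Num.sqrt (2 / a) + eps)) @[r --> +oo] --> 1%E).
Proof.
move=> rigid.
have M0 : 0 < M by apply: le_lt_trans hM; exact: sqrtr_ge0.
(* The absolute value makes the constant nonnegative without losing the bound. *)
have [K0 hK0] := hlog; set K := `|K0|.
pose tailC := C * expR (M ^+ 2 / 2 * (2 * K + a * M * (a + K)) + 2 * K / a).
have tailC0 : 0 < tailC by rewrite mulr_gt0// expR_gt0.
(* A single threshold [r1] serves all [t] and [eps]: only the asymptotic hypotheses enter its
   choice. *)
have [r1 [r1_gt0 good]] : exists r1, 0 < r1 /\ forall r, r1 <= r ->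
    [/\ 1 <= mu r ((eta1 r + delta r) * r),
        (forall t, 0 <= t -> measurable (rigid r t)) &
        (forall t eps, 0 < t -> t <= M -> 0 < eps -> eps <= 1 ->
          t ^+ 2 = 2 / a * (1 + eps) ->
          ((1 - 2 * tailC * (mu r ((eta1 r + delta r) * r) `^ (- eps) / eps))%:E
            <= P r (rigid r t))%E)].
  have near_mu : \forall r \near +oo, 1 <= mu r ((eta1 r + delta r) * r).
    by move/cvgryPge : hmu_lim; exact.
  have near_sigma : \forall r \near +oo, 1 <= sigma r ((eta1 r + delta r) * r).
    by move/cvgryPge : hsigma_lim; exact.
  pose slope_inf r := ereal_inf
      [set (delta r * r
             * derive_on `[eta1 r * r, eta2 r * r]%classic (mu r) (x * r)
             / sigma r (y * r) ^+ 2)%:E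
        | x in `]eta1 r + delta r / 2, eta2 r - delta r / 2[%classic
        & y in `]eta1 r + delta r / 2, eta2 r - delta r / 2[%classic].
  have near_inf : \forall r \near +oo, ((M + 1)%:E <= slope_inf r)%E.
    by move/cvgeyPge : hinf; exact.
  have [N [_ hN]] := filterI hK0 (filterI near_mu (filterI near_sigma near_inf)).
  (* Adding 1 turns [r1 <= r] into the strict inequalities [N < r] and [r0 < r]. *)
  have r1_gt : 0 < Num.max (N + 1) (r0 + 1) by rewrite lt_max; apply/orP; right; lra.
  exists (Num.max (N + 1) (r0 + 1)); split => // r; rewrite ge_max => /andP[Nr r0r].
  have /hN[hlogr [mu1 [sigma1 infr]]] : N < r by lra.
  have {Nr}r0r : r0 < r by lra.
  have r_gt0 : 0 < r by lra.
  have [eta1_gt0 eta12] := heta r (ltW r0r).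
  have /andP[delta_gt0 delta_lt] := hdelta r (ltW r0r).
  have delta5 : 5 * delta r < eta2 r - eta1 r by move: delta_lt; lra.
  rewrite /slope_inf in infr.
  set A := eta1 r * r in infr hlogr *; set B := eta2 r * r in infr hlogr *.
  pose x1 := (eta1 r + delta r / 2) * r; pose x2 := (eta1 r + delta r) * r.
  pose x3 := (eta1 r + 2 * delta r) * r; pose y3 := (eta2 r - 2 * delta r) * r.
  pose y2 := (eta2 r - delta r) * r; pose y1 := (eta2 r - delta r / 2) * r.
  have Ax1 : A < x1 by rewrite /A /x1 ltr_pM2r//; lra.
  have x12 : x1 < x2 by rewrite /x1 /x2 ltr_pM2r//; lra.
  have x23 : x2 < x3 by rewrite /x2 /x3 ltr_pM2r//; lra.
  have x3y3 : x3 < y3 by rewrite /x3 /y3 ltr_pM2r//; lra.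
  have y32 : y3 < y2 by rewrite /y3 /y2 ltr_pM2r//; lra.
  have y21 : y2 < y1 by rewrite /y2 /y1 ltr_pM2r//; lra.
  have y1B : y1 < B by rewrite /y1 /B ltr_pM2r//; lra.
  have x23E : x3 - x2 = delta r * r by rewrite /x3 /x2; ring.
  have y32E : y2 - y3 = delta r * r by rewrite /y3 /y2; ring.
  have muinc := hmu_incr r r0r; have sigmainc := hsigma_incr r r0r.
  have mudiff := hmu_diff r r0r.
  have sigma0 x : A <= x <= B -> 0 <= sigma r x.
    by move=> xAB; apply: (hsigma0 r (ltW r0r)); rewrite in_itv.
  have scaled x : x1 < x < y1 ->
      `]eta1 r + delta r / 2, eta2 r - delta r / 2[%classic (x / r).
    by rewrite /= in_itv/= ltr_pdivlMr// ltr_pdivrMr.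
  have slope x z : x1 < x < y1 -> x1 < z < y1 ->
      (M + 1) * sigma r z ^+ 2 <=
      delta r * r * derive_on `[A, B]%classic (mu r) x.
    move=> xr zr.
    have : ((M + 1)%:E <= (delta r * r * derive_on `[A, B]%classic (mu r) x
        / sigma r z ^+ 2)%:E)%E.
      apply: (le_trans infr); apply: ereal_inf_lbound.
      exists (x / r); first exact: scaled.
      exists (z / r); first exact: scaled.
      by rewrite !divfK ?gt_eqF.
    have AB : A < B by rewrite /A /B ltr_pM2r.
    (* Positivity is needed to clear the denominator of the slope ratio. *)
    have sz : 0 < sigma r z.
      have /andP[xz zy] := zr; have Az := lt_trans Ax1 xz.
      apply: (@le_lt_trans _ _ (sigma r A)).
        by apply: sigma0; rewrite lexx ltW.
      apply: sigmainc => //; rewrite /= in_itv/= ?lexx ltW//.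
      by rewrite ltW// (lt_trans zy).
    by rewrite lee_fin ler_pdivlMr ?exprn_gt0.
  have vlog k : mu r x1 <= k <= mu r y1 ->
      `|sq_comp_inv `[A, B]%classic (sigma r) (mu r) k - a * ln k| <= K.
    by move=> kr; apply: le_trans (hlogr k _) (ler_norm K0); rewrite in_itv.
  have expmom gamma x : - M <= gamma <= M -> x1 < x < y1 ->
      (\int[P r]_w expeR (gamma%:E * npoints_le (X r w) x) <=
       (C * expR (gamma * mu r x + gamma ^+ 2 / 2 * sigma r x ^+ 2))%:E)%E.
    move=> gM xr; have := hexp gamma (x / r) r r0r.
    rewrite divfK ?gt_eqF//; apply; first by rewrite in_itv.
    exact: scaled.
  have Xfin := hX r (ltW r_gt0).
  split=> // [t t0|t eps t0 tM eps0 eps1 tE].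
    exact: (@measurable_rigidity _ _ _ (X r) A x1 x2 x3 y3 y2 y1 B).
  have K_ge0 : 0 <= K by exact: normr_ge0.
  exact: (@rigidity_bound _ _ _ (P r) (X r) a M C K (delta r * r) A x1 x2 x3 y3 y2 y1 B).
have a2 : 0 < 2 / a by rewrite divr_gt0.
have M2 : 2 / a < M ^+ 2.
  by rewrite -(sqr_sqrtr (ltW a2)) ltr_pXn2r ?nnegrE ?sqrtr_ge0// ltW.
(* The second term is the largest [eps] with [2 / a * (1 + eps) <= M ^+ 2], so that the level is an
   admissible [gamma]; it is positive because [M] exceeds [Num.sqrt (2 / a)]. *)
pose eps0 := Num.min 1 (a * M ^+ 2 / 2 - 1).
have eps0_gt0 : 0 < eps0.
  rewrite lt_min ltr01 /= subr_gt0 ltr_pdivlMr// mul1r.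
  by move: M2; rewrite ltr_pdivrMr// mulrC.
have level eps : 0 < eps -> eps <= eps0 ->
    [/\ 0 < Num.sqrt (2 / a * (1 + eps)), Num.sqrt (2 / a * (1 + eps)) <= M,
        eps <= 1 & Num.sqrt (2 / a * (1 + eps)) ^+ 2 = 2 / a * (1 + eps)].
  move=> eps_gt0; rewrite le_min => /andP[eps_le1 eps_leM].
  have e0 : 0 < 2 / a * (1 + eps) by rewrite mulr_gt0// addr_gt0.
  split=> //; [by rewrite sqrtr_gt0| |by rewrite sqr_sqrtr// ltW].
  rewrite -(ler_pXn2r (n := 2))// ?nnegrE ?sqrtr_ge0 ?(ltW M0)// sqr_sqrtr ?(ltW e0)//.
  rewrite mulrAC ler_pdivrMr// (mulrC _ a); move: eps_leM; clear; lra.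
have lambda0 : 0 < lambda by exact: lt_trans hlambda.
have bound eps r : 0 < eps -> eps <= eps0 -> r1 <= r ->
    ((1 - 2 * tailC * mu r ((eta1 r + delta r) * r) `^ (- (eps / lambda)) / eps)%:E
     <= P r (rigid r (Num.sqrt (2 / a * (1 + eps)))))%E.
  move=> eps_gt0 eps_le /good[mu1 _ /(_ _ _ _ _ _ _ _) bd].
  have [s0 sM e1 sE] := level _ eps_gt0 eps_le.
  apply: le_trans (bd _ _ s0 sM eps_gt0 e1 sE).
  (* The exponent [- eps] is weakened to [- (eps / lambda)], which is legitimate since the base is
     at least 1 and [lambda > 1]. *)
  rewrite lee_fin lerD2l lerN2 -[leRHS]mulrA ler_pM2l; last exact: mulr_gt0.
  rewrite ler_pM2r ?invr_gt0//; apply: ler_powR => //.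
  by rewrite lerN2 ler_pdivrMr// ler_peMr// ltW.
split.
  exists (2 * tailC), r1; split=> //; first exact: mulr_gt0.
  exists eps0 => // eps r /andP[eps_gt0 /ltW eps_le] r1r.
  exact: bound.
move=> eps eps_gt0.
have s2a : 0 < Num.sqrt (2 / a) by rewrite sqrtr_gt0.
(* The second term gives [sqrt (2 / a) * (1 + e) <= sqrt (2 / a) + eps], while
   [sqrt (1 + e) <= 1 + e]. *)
pose e := Num.min eps0 (eps / Num.sqrt (2 / a)).
have e_gt0 : 0 < e by rewrite lt_min eps0_gt0 divr_gt0.
have e_le : e <= eps0 by rewrite ge_min lexx.
have sqrt_le : Num.sqrt (2 / a * (1 + e)) <= Num.sqrt (2 / a) + eps.
  have e1_gt0 : 0 < 1 + e by rewrite addr_gt0.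
  rewrite (sqrtrM (1 + e) (ltW a2)).
  apply: (@le_trans _ _ (Num.sqrt (2 / a) * (1 + e))).
    rewrite ler_pM2l// -(ler_pXn2r (n := 2))// ?nnegrE ?sqrtr_ge0 ?(ltW e1_gt0)//.
    by rewrite (sqr_sqrtr (ltW e1_gt0)) expr2 ler_peMr ?(ltW e1_gt0)// lerDl ltW.
  rewrite mulrDr mulr1 lerD2l mulrC -ler_pdivlMr//.
  by rewrite ge_min lexx orbT.
have tail_cvg : (1 - 2 * tailC * mu r ((eta1 r + delta r) * r) `^ (- (e / lambda)) / e)%:E
    @[r --> +oo] --> 1%E.
  have el0 : 0 < e / lambda by rewrite divr_gt0.
  rewrite -[X in _ --> X%:E](subr0 1); apply: cvg_EFin; first exact: nearW.
  apply: cvgB; first exact: cvg_cst.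
  rewrite -[X in _ --> X](mul0r e^-1); apply: cvgMl.
  rewrite -[X in _ --> X](mulr0 (2 * tailC)); apply: cvgMr.
  exact: cvg_powRN_pinfty.
apply: (squeeze_cvge _ tail_cvg (cvg_cst 1%E)).
near=> r.
have r1r : r1 <= r by near: r; apply: nbhs_pinfty_ge; exact: num_real.
have [_ mrigid _] := good r r1r.
have mt := mrigid _ (addr_ge0 (sqrtr_ge0 (2 / a)) (ltW eps_gt0)).
apply/andP; split; last exact: probability_le1.
apply: le_trans (bound e r e_gt0 e_le r1r) _.
(* The rigidity event grows with its level, and [sqrt_le] compares the two levels. *)
apply: le_measure; rewrite ?inE; [| |].
- exact: mrigid (sqrtr_ge0 _).
- exact: mt.
- by move=> w [kth dev]; split=> //; exact: le_trans sqrt_le.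
Unshelve. all: by end_near.
Qed.
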